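(* Fix $k\in\{1,\dots,r\}$ and suppose the $N_v\times N_v$ matrix $\mathcal{Q}_{x_k}$ satisfies the summation-by-parts property $$\mathcal{Q}_{x_k}+\mathcal{Q}_{x_k}^\top = E^\top P N_{x_k}E .$$ For vectors $\boldsymbol{\Phi},\boldsymbol{\Psi}\in\mathbb{R}^{N_v}$ put $\boldsymbol{\phi}=E\boldsymbol{\Phi}$, $\boldsymbol{\psi}=E\boldsymbol{\Psi}\in\mathbb{R}^{N_s}$ and define $$\mathcal{Q}_{x_k,\boldsymbol{\Phi},\boldsymbol{\Psi}}=\underline{\boldsymbol{\Psi}}\,\mathcal{Q}_{x_k}\,\underline{\boldsymbol{\Phi}}+\tfrac12\big(\underline{\boldsymbol{\psi}}E+E\underline{\boldsymbol{\Psi}}\big)^\top P N_{x_k}\big(\underline{\boldsymbol{\phi}}E-E\underline{\boldsymbol{\Phi}}\big),$$ so that $\mathcal{Q}_{x_k,\boldsymbol{\Psi},\boldsymbol{\Phi}}$ denotes the matrix obtained by interchanging the roles of $(\boldsymbol{\Phi},\boldsymbol{\phi})$ and $(\boldsymbol{\Psi},\boldsymbol{\psi})$. Then for arbitrary vectors $\boldsymbol{\Phi},\boldsymbol{\Psi}$ of length $N_v$, $$\mathcal{Q}_{x_k,\boldsymbol{\Phi},\boldsymbol{\Psi}}+\mathcal{Q}_{x_k,\boldsymbol{\Psi},\boldsymbol{\Phi}}^\top=(\underline{\boldsymbol{\psi}}E)^\top P N_{x_k}(\underline{\boldsymbol{\phi}}E).$$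
   Context: All matrices are real. $N_v$ and $N_s$ are the numbers of volume and surface nodes of a discretization of a domain $\Omega\subseteq\mathbb{R}^r$ and its boundary. A (generalized, diagonal norm) summation-by-parts (SBP) operator for $\partial/\partial x_k$ is $\mathcal{D}_{x_k}=\mathcal{P}^{-1}\mathcal{Q}_{x_k}$ where $\mathcal{P}>0$ is an $N_v\times N_v$ diagonal matrix of volume quadrature weights, $P>0$ is an $N_s\times N_s$ diagonal matrix of surface quadrature weights, $N_{x_k}$ is an $N_s\times N_s$ diagonal matrix (of exact or approximate values of the $k$-th component of the outward unit normal), and $E$ is an $N_s\times N_v$ matrix (projection from volume nodes to surface nodes), with $\mathcal{Q}_{x_k}+\mathcal{Q}_{x_k}^\top=E^\top PN_{x_k}E$. The surface nodes need not be a subset of the volume nodes, so $E$ is a general rectangular matrix. For a vector $\boldsymbol{a}$, $\underline{\boldsymbol{a}}$ denotes the diagonal matrix with the entries of $\boldsymbol{a}$ on its diagonal. The discrete approximation of $\psi(\phi u)_{x_k}$ is $\mathcal{P}^{-1}\mathcal{Q}_{x_k,\boldsymbol{\Phi},\boldsymbol{\Psi}}\boldsymbol{U}$. *)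

(* Defs.v *)
From mathcomp Require Import all_boot all_order all_algebra.
From mathcomp Require Import reals.

Set Implicit Arguments.
Unset Strict Implicit.
Unset Printing Implicit Defensive.

Import Order.TTheory GRing.Theory Num.Theory.

Local Open Scope ring_scope.

(* Diagonal matrix of a column vector; diag_mx expects a row vector. *)
Definition diagc (R : realType) (n : nat) (a : 'cV[R]_n) : 'M[R]_n :=
  diag_mx a^T.

(* For a diagonal matrix of quadrature weights, "> 0" means that every weight
   is positive. *)
Definition posdiag_mx (R : realType) (n : nat) (A : 'M[R]_n) : Prop :=
  is_diag_mx A /\ forall i : 'I_n, 0 < A i i.

Definition sbp_property (R : realType) (Nv Ns : nat) (Q : 'M[R]_Nv)
    (E : 'M[R]_(Ns, Nv)) (P N : 'M[R]_Ns) : Prop :=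
  Q + Q^T = E^T *m P *m N *m E.

(* P^-1 Q_{Phi,Psi} U, with P the volume quadrature, approximates
   psi * d(phi * u)/dx_k: the first vector argument is the inner coefficient,
   the second the outer one. *)
Definition Qvar (R : realType) (Nv Ns : nat) (Q : 'M[R]_Nv)
    (E : 'M[R]_(Ns, Nv)) (P N : 'M[R]_Ns) (Phi Psi : 'cV[R]_Nv) : 'M[R]_Nv :=
  let phi := E *m Phi in
  let psi := E *m Psi in
  diagc Psi *m Q *m diagc Phi
  + 2^-1 *: ((diagc psi *m E + E *m diagc Psi)^T *m P *m N
             *m (diagc phi *m E - E *m diagc Phi)).

(* Main.v *)
Require Import Defs.
From mathcomp Require Import all_boot all_order all_algebra.
From mathcomp Require Import reals.

Import Order.TTheory GRing.Theory Num.Theory.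

Local Open Scope ring_scope.

(** Write [M := P *m N k], and abbreviate [A := diagc psi *m E],
    [B := E *m diagc Psi], [C := diagc phi *m E], [D := E *m diagc Phi], where
    [psi := E *m Psi] and [phi := E *m Phi].  The volume parts of the two
    operators add up, by the summation-by-parts property, to
    [diagc Psi *m (Q + Q^T) *m diagc Phi = B^T *m M *m D]: the boundary term
    in which the coefficients are applied before projecting to the surface.
    The correction terms are chosen to exchange this for the boundary term
    [A^T *m M *m C], in which the projected coefficients multiply on the
    surface.  Their sum is [A^T *m M *m C - B^T *m M *m D], because the mixed
    products cancel once the second correction is transposed
    ([polarization_mx]).  That transposition must leave [M] in place, so it
    uses that [M], a product of diagonal matrices, is symmetric
    ([trmx_mul_diag]). *)

Lemma trmx_mul_diag (R : comPzRingType) (n : nat) (A B : 'M[R]_n) :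
  is_diag_mx A -> is_diag_mx B -> (A *m B)^T = A *m B.
Proof.
move=> /diag_mxP[a ->] /diag_mxP[b ->].
by rewrite trmx_mul !tr_diag_mx diag_mxC.
Qed.

(** Matrix form of
    [(a + b) * (c - d) + (a - b) * (c + d) = 2 * (a * c - b * d)]; the
    symmetry of [M] turns the transposed product into the second summand. *)
Lemma polarization_mx (R : numFieldType) (m n p : nat) (M : 'M[R]_m)
    (A B : 'M[R]_(m, n)) (C D : 'M[R]_(m, p)) :
  M^T = M ->
  2^-1 *: ((A + B)^T *m M *m (C - D))
  + (2^-1 *: ((C + D)^T *m M *m (A - B)))^T
  = A^T *m M *m C - B^T *m M *m D.
Proof.
move=> symM.
rewrite linearZ /= -scalerDr !trmx_mul trmxK symM !mulmxA.
rewrite [(A + B)^T]linearD [(A - B)^T]linearB /=.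
rewrite !(mulmxDl, mulmxDr, mulmxBl, mulmxBr, mulNmx, mulmxN).
set ac := A^T *m M *m C; set ad := A^T *m M *m D.
set bc := B^T *m M *m C; set bd := B^T *m M *m D.
have -> : ac + bc + (- ad - bd) + (ac - bc + (ad - bd)) = (ac - bd) *+ 2.
  rewrite addrACA [ac + bc + _]addrACA [- ad - bd + _]addrACA.
  by rewrite subrr addr0 addNr add0r addrACA mulr2n.
by rewrite -scaler_nat scalerA mulVf ?pnatr_eq0 // scale1r.
Qed.

Theorem proposition1 (R : realType) (r Nv Ns : nat)
    (Q : 'I_r -> 'M[R]_Nv) (E : 'M[R]_(Ns, Nv))
    (P : 'M[R]_Ns) (N : 'I_r -> 'M[R]_Ns)
    (P_pos : posdiag_mx P) (N_diag : forall j : 'I_r, is_diag_mx (N j))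
    (k : 'I_r) (Q_sbp : sbp_property (Q k) E P (N k))
    (Phi Psi : 'cV[R]_Nv) :
  Qvar (Q k) E P (N k) Phi Psi + (Qvar (Q k) E P (N k) Psi Phi)^T
  = (diagc (E *m Psi) *m E)^T *m P *m N k *m (diagc (E *m Phi) *m E).
Proof.
have symPN : (P *m N k)^T = P *m N k by apply: trmx_mul_diag; first case: P_pos.
have tr_diagc (a : 'cV[R]_Nv) : (diagc a)^T = diagc a by apply: tr_diag_mx.
have volume : diagc Psi *m Q k *m diagc Phi + (diagc Phi *m Q k *m diagc Psi)^T
    = (E *m diagc Psi)^T *m (P *m N k) *m (E *m diagc Phi).
  rewrite !trmx_mul !tr_diagc (mulmxA (diagc Psi) (Q k)^T).
  by rewrite -mulmxDl -mulmxDr Q_sbp !mulmxA.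
rewrite /Qvar [X in _ + X]linearD /= addrACA volume -!(mulmxA _ P (N k)).
by rewrite polarization_mx // addrC subrK.
Qed.
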